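(* Let $m$ be a positive integer and let $\xi,\eta$ be positive irrational numbers with $\xi\eta=m$ and $\eta<m$. Let $n\ge1$ be an integer, let $\frac{p}{q}=\frac{p_{n-1}}{q_{n-1}}$ be the corresponding convergent to $\xi$, and suppose that the partial quotient $b=b_n$ belonging to it satisfies $b\ge 2m+1$. Then $\frac{p}{q}$ has a connection to $m\frac{q}{p}$, that is, $m\frac{q}{p}$ is a convergent to $\eta$: there exists an integer $k\ge1$ with $\frac{P_{k-1}}{Q_{k-1}}=m\frac{q}{p}$, so that the triplets $\left(\frac{p_{n-1}}{q_{n-1}},\xi_n,b_n\right)$ and $\left(\frac{P_{k-1}}{Q_{k-1}},\eta_k,B_k\right)$ are connected.
   Context: For a positive irrational number $\xi$, the regular continued fraction expansion is defined by $\xi_0=\xi$, $b_0=\lfloor \xi\rfloor$, and $\xi_j=\frac{1}{\xi_{j-1}-b_{j-1}}$, $b_j=\lfloor \xi_j\rfloor$ for $j\ge1$. The $\xi_j$ are the complete quotients and the $b_j$ the partial quotients. The convergents $\frac{p_j}{q_j}$ are given by $p_{-1}=1$, $q_{-1}=0$, $p_0=b_0$, $q_0=1$, and $p_j=b_jp_{j-1}+p_{j-2}$, $q_j=b_jq_{j-1}+q_{j-2}$ for $j\ge 1$. The partial quotient belonging to the convergent $\frac{p_{n-1}}{q_{n-1}}$ is the next one, $b_n$. For $\eta=m/\xi$, the complete quotients, partial quotients and convergents, defined in the same way, are denoted $\eta_j$, $B_j$, $\frac{P_j}{Q_j}$. For integers $n,k\ge1$, the triplets $\left(\frac{p_{n-1}}{q_{n-1}},\xi_n,b_n\right)$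 and $\left(\frac{P_{k-1}}{Q_{k-1}},\eta_k,B_k\right)$ are called connected if $\frac{p_{n-1}}{q_{n-1}}\cdot\frac{P_{k-1}}{Q_{k-1}}=m$. *)

(* Defs.v *)
From mathcomp Require Import all_boot all_order all_algebra.
From mathcomp Require Import all_classical all_reals.

Set Implicit Arguments.
Unset Strict Implicit.
Unset Printing Implicit Defensive.

Import Order.TTheory GRing.Theory Num.Theory.

Local Open Scope ring_scope.

(* Regular continued fraction expansion of a real number.  The definitions are
   total, but are meant for irrational arguments: the expansion then never
   terminates, so no division by zero occurs in [cf_complete]. *)
Section ContinuedFraction.
Variable R : realType.
Implicit Types (x : R) (j n : nat).

Fixpoint cf_complete x j : R :=
  if j is i.+1 then (cf_complete x i - (Num.floor (cf_complete x i))%:~R)^-1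
  else x.

Definition cf_partial x j : int := Num.floor (cf_complete x j).

(* The inner [else] branches supply the values of index -1. *)
Fixpoint cf_num x j : int :=
  if j is i.+1 then
    cf_partial x j * cf_num x i + (if i is h.+1 then cf_num x h else 1)
  else cf_partial x 0.

Fixpoint cf_den x j : int :=
  if j is i.+1 then
    cf_partial x j * cf_den x i + (if i is h.+1 then cf_den x h else 0)
  else 1.

Definition cf_convergent x j : R := (cf_num x j)%:~R / (cf_den x j)%:~R.

(* Meant for 1 <= n: the convergent of index n - 1 goes with the complete and
   partial quotients of index n. *)
Definition cf_triplet x n : R * R * int :=
  (cf_convergent x n.-1, cf_complete x n, cf_partial x n).

Definition connected_triplets (m : nat) (t u : R * R * int) : Prop :=
  t.1.1 * u.1.1 = m%:R.

End ContinuedFraction.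

(* Main.v *)
Require Import Defs.
From mathcomp Require Import all_boot all_order all_algebra.
From mathcomp Require Import all_classical all_reals.
From mathcomp Require Import zify ring lra.

(** Write [x] for [xi], [y] for its complete quotient of index [n], and [p/q],
    [p'/q'] for the convergents of [x] of indices [n-1] and [n-2].  Since
    [x (q y + q') = p y + p'] (lemma [cf_mobius]) and [p q' - p' q] is a sign
    (lemma [cf_det]), the error of [p/q] satisfies [|q x - p| (q y + q') = 1]
    (lemma [cf_error_norm]).

    The fraction [m q / p] approximates [eta = m / x] with
    [p eta - m q = - eta (q x - p)], so its error times twice its denominator is
    [2 p eta |q x - p| = 2 p m / (x (q y + q')) = 2 p m / (p y + p')].
    A partial quotient larger than [2 m] gives [y > 2 m], and the quotient above
    is then less than 1.  The condition [eta < m] means [x > 1], which makes [p]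
    positive and [p'] nonnegative, so that [p] is an admissible denominator.

    Legendre's criterion (lemma [legendre_convergent]) now says that [m q / p]
    is a convergent to [eta].  The criterion holds for fractions that are not in
    lowest terms, so a common factor of [p] and [m] is harmless.  It rests on
    the best approximation property of convergents, lemma [cf_error_best]. *)

Import Order.TTheory GRing.Theory Num.Theory.

Local Open Scope ring_scope.

(** * Complete quotients and the recurrence of the convergents *)

(** The value at [j] is the numerator of index [j-1], so that the recurrence and
    the identities below cover the index [-1] without a case distinction. *)
Definition cf_num_before {R : realType} (x : R) (j : nat) : int :=
  if j is i.+1 then cf_num x i else 1.

Definition cf_den_before {R : realType} (x : R) (j : nat) : int :=
  if j is i.+1 then cf_den x i else 0.

Definition cf_error {R : realType} (x : R) (j : nat) : R :=
  (cf_den x j)%:~R * x - (cf_num x j)%:~R.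

Lemma cf_numS {R : realType} (x : R) (j : nat) :
  cf_num x j.+1 = cf_partial x j.+1 * cf_num x j + cf_num_before x j.
Proof. by case: j. Qed.

Lemma cf_denS {R : realType} (x : R) (j : nat) :
  cf_den x j.+1 = cf_partial x j.+1 * cf_den x j + cf_den_before x j.
Proof. by case: j. Qed.

Lemma cf_completeS {R : realType} (x : R) (j : nat) :
  cf_complete x j.+1 = (cf_complete x j - (cf_partial x j)%:~R)^-1.
Proof. by []. Qed.

Lemma irrational_inv_subz {R : realType} {x : R} (b : int) :
  irrational x -> irrational (x - b%:~R)^-1.
Proof.
move=> xirr [r _ rE]; apply: xirr; exists (r^-1 + b%:~R) => //.
by rewrite rmorphD fmorphV rmorph_int /= rE invrK subrK.
Qed.

Lemma irrational_neq_int {R : realType} {x : R} (b : int) :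
  irrational x -> x != b%:~R.
Proof.
by move=> xirr; apply/eqP => xb; apply: xirr; exists b%:~R; rewrite ?rmorph_int.
Qed.

Lemma cf_complete_irrational {R : realType} {x : R} (j : nat) :
  irrational x -> irrational (cf_complete x j).
Proof.
by move=> xirr; elim: j => // j IHj; rewrite cf_completeS; exact: irrational_inv_subz.
Qed.

(** Irrationality makes the floor strict, so the expansion never divides by
    zero. *)
Lemma cf_partial_lt {R : realType} {x : R} (j : nat) :
  irrational x -> (cf_partial x j)%:~R < cf_complete x j.
Proof.
move=> xirr; rewrite lt_neqAle floor_le andbT eq_sym.
exact/irrational_neq_int/cf_complete_irrational.
Qed.

Lemma cf_completeS_gt1 {R : realType} {x : R} (j : nat) :
  irrational x -> 1 < cf_complete x j.+1.
Proof.
move=> xirr; have lt_b := cf_partial_lt j xirr.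
have /andP[_] := floor_itv (cf_complete x j); rewrite intrD -/(cf_partial x j) => ub.
by rewrite cf_completeS invf_gt1 ?subr_gt0 // ltrBlDl.
Qed.

Lemma cf_partialS_ge1 {R : realType} {x : R} (j : nat) :
  irrational x -> 1 <= cf_partial x j.+1.
Proof.
by move=> xirr; rewrite /cf_partial floor_ge_int ltW ?cf_completeS_gt1.
Qed.

(** * Error of a convergent *)

(** The number is recovered from its expansion when the last partial quotient is
    replaced by the complete quotient: the step from [j] to [j+1] substitutes
    [b + 1/z] for the complete quotient, which is what the recurrence does to the
    coefficients. *)
Lemma cf_mobius {R : realType} {x : R} (j : nat) : irrational x ->
  x * ((cf_den x j)%:~R * cf_complete x j.+1 + (cf_den_before x j)%:~R)
  = (cf_num x j)%:~R * cf_complete x j.+1 + (cf_num_before x j)%:~R.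
Proof.
move=> xirr; elim: j => [|j IHj].
  have := cf_partial_lt 0 xirr; rewrite cf_completeS /= => lt_b.
  by field; rewrite subr_eq0 gt_eqF.
have lt_b := cf_partial_lt j.+1 xirr.
rewrite cf_numS cf_denS !intrD !intrM (cf_completeS x j.+1).
rewrite [cf_num_before x j.+1]/= [cf_den_before x j.+1]/=.
move: IHj lt_b; set y := cf_complete x j.+1; set b := cf_partial x j.+1.
move=> IHj lt_b.
have yK : (y - b%:~R)^-1 * (y - b%:~R) = 1.
  by rewrite mulVf // subr_eq0 gt_eqF.
move: (y - b%:~R)^-1 yK => z yK; apply/eqP; rewrite -subr_eq0; apply/eqP.
(* With z the next complete quotient, so that z (y - b) = 1, the difference of
   the two sides is z times that of the induction hypothesis, up to a multiple
   of 1 - z (y - b). *)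
rewrite [LHS](_ : _ = z * (x * ((cf_den x j)%:~R * y + (cf_den_before x j)%:~R)
    - ((cf_num x j)%:~R * y + (cf_num_before x j)%:~R))
  + (x * (cf_den x j)%:~R - (cf_num x j)%:~R) * (1 - z * (y - b%:~R))); last by ring.
by rewrite IHj yK !subrr !mulr0 addr0.
Qed.

(** Consecutive errors have opposite signs, which is what best approximation
    needs; this is [cf_mobius] with the terms regrouped. *)
Lemma cf_error_complete {R : realType} {x : R} (j : nat) : irrational x ->
  cf_error x j = - (cf_complete x j.+2 * cf_error x j.+1).
Proof.
by move=> xirr; have := cf_mobius j.+1 xirr; rewrite /cf_error /=; lra.
Qed.

Lemma cf_det {R : realType} (x : R) (j : nat) :
  cf_num x j * cf_den_before x j - cf_num_before x j * cf_den x j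
  = (-1) ^+ j.+1.
Proof.
elim: j => [|j IHj]; first by rewrite /=; ring.
by rewrite cf_numS cf_denS /= exprS -IHj; ring.
Qed.

(** By [cf_mobius] the product is minus the determinant of two consecutive
    convergents. *)
Lemma cf_error_norm {R : realType} {x : R} (j : nat) : irrational x ->
  `|cf_error x j * ((cf_den x j)%:~R * cf_complete x j.+1
                    + (cf_den_before x j)%:~R)| = 1.
Proof.
move=> xirr; have mobius := cf_mobius j xirr.
have -> : cf_error x j * ((cf_den x j)%:~R * cf_complete x j.+1
      + (cf_den_before x j)%:~R)
    = - (cf_num x j * cf_den_before x j - cf_num_before x j * cf_den x j)%:~R.
  by rewrite /cf_error mulrBl -mulrA mobius intrB !intrM; ring.
by rewrite cf_det rmorphXn rmorphN1 normrN normr_sign.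
Qed.

(** * Growth of numerators and denominators *)

Lemma cf_num_bounds {R : realType} {x : R} (j : nat) : irrational x -> 1 < x ->
  1 <= cf_num x j /\ 0 <= cf_num_before x j.
Proof.
move=> xirr x_gt1; elim: j => [|j [IH1 IH2]].
  by rewrite /= /cf_partial floor_ge_int ltW.
have := cf_partialS_ge1 j xirr; rewrite cf_numS [cf_num_before x j.+1]/=; nia.
Qed.

Lemma cf_den_bounds {R : realType} {x : R} (j : nat) : irrational x ->
  1 <= cf_den x j /\ 0 <= cf_den_before x j.
Proof.
move=> xirr; elim: j => [|j [IH1 IH2]] //.
have := cf_partialS_ge1 j xirr; rewrite cf_denS [cf_den_before x j.+1]/=; nia.
Qed.

Lemma cf_denS_ge {R : realType} {x : R} (j : nat) : irrational x ->
  j.+1%:Z <= cf_den x j.+1.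
Proof.
move=> xirr; elim: j => [|j IHj].
  by have := cf_partialS_ge1 0 xirr; rewrite /=; lia.
have [den_ge1 _] := cf_den_bounds j xirr.
by have := cf_partialS_ge1 j.+1 xirr; rewrite cf_denS [cf_den_before x j.+1]/=; nia.
Qed.

Lemma cf_den_bracket {R : realType} {x : R} {Q : int} : irrational x -> 1 <= Q ->
  exists j, cf_den x j <= Q < cf_den x j.+1.
Proof.
move=> xirr Q_ge1.
have exQ : exists j, Q < cf_den x j.+1.
  by exists `|Q|%N; have := cf_denS_ge `|Q|%N xirr; lia.
(* At the least such index j the lower bound is the failure of the condition at
   j - 1, or, for j = 0, the initial denominator 1. *)
exists (ex_minn exQ); case: ex_minnP => [[|j] ltQ minj]; rewrite ltQ andbT //.
by rewrite leNgt; apply/negP => /minj; rewrite ltnn.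
Qed.

(** * Best approximation and Legendre's criterion *)

(** The vectors of numerator and denominator of two consecutive convergents form
    a basis of the integer lattice.  In this basis [(P, Q)] has coordinates
    [(a, c)], and [0 < Q < q_(j+1)] forces [a] to be nonzero and [c] not to have
    the sign of [a].  As consecutive errors have opposite signs too, the
    contributions of [a] and [c] to [Q x - P] add up in absolute value, and the
    first is at least the error of index [j]. *)
Lemma cf_error_best {R : realType} {x : R} {j : nat} (P : int) {Q : int} :
  irrational x -> 1 <= Q < cf_den x j.+1 ->
  `|cf_error x j| <= `|Q%:~R * x - P%:~R|.
Proof.
move=> xirr /andP[Q_ge1 Q_lt].
have [qj_ge1 _] := cf_den_bounds j xirr.
have [a [c [QE PE]]] : exists a c : int,
    Q = a * cf_den x j + c * cf_den x j.+1
    /\ P = a * cf_num x j + c * cf_num x j.+1.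
  set D := (-1) ^+ j.+2 : int.
  have D2 : D * D = 1 by rewrite -expr2 sqrr_sign.
  have := cf_det x j.+1; rewrite [cf_num_before _ _]/= [cf_den_before _ _]/= -/D => detE.
  (* Cramer's rule; dividing by the determinant D is multiplying by it. *)
  exists (D * (Q * cf_num x j.+1 - P * cf_den x j.+1)).
  exists (D * (P * cf_den x j - Q * cf_num x j)).
  by split; rewrite -[LHS]mul1r -D2 -{2}detE; ring.
have X_gt1 := cf_completeS_gt1 j.+1 xirr.
rewrite (cf_error_complete j xirr).
have -> : Q%:~R * x - P%:~R
    = (c%:~R - a%:~R * cf_complete x j.+2) * cf_error x j.+1.
  have := cf_error_complete j xirr.
  by rewrite QE PE !intrD !intrM /cf_error; nra.
rewrite normrN !normrM ler_wpM2r // (gtr0_norm (lt_trans ltr01 X_gt1)).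
have [[a_ge1 c_le0]|[a_le c_ge0]] : (1 <= a /\ c <= 0) \/ (a <= -1 /\ 0 <= c).
- move: (cf_den x j) (cf_den x j.+1) qj_ge1 QE Q_lt => q q1 q_ge1 QE Q_lt.
  have [a_ge1|a_le0] := lerP 1 a.
    by left; split=> //; rewrite leNgt; apply/negP => c_gt0; nia.
  have [a_le|a_gt] := lerP a (-1).
    by right; split=> //; rewrite leNgt; apply/negP => c_lt0; nia.
  have a0 : a = 0 by lia.
  rewrite a0 mul0r add0r in QE.
  have [c_ge1|c_le0] := lerP 1 c; nia.
- rewrite -(ler_int R) in a_ge1; rewrite -(ler_int R) in c_le0.
  by rewrite distrC; apply: le_trans (ler_norm _); nra.
- rewrite -(ler_int R) in a_le; rewrite -(ler_int R) in c_ge0.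
  by apply: le_trans (ler_norm _); nra.
Qed.

(** Take the convergent [p/q] with [q <= Q] and [Q] below the next denominator.
    The integer [P q - p Q] equals [Q (q x - p) - q (Q x - P)]; by best
    approximation both terms are at most [Q |Q x - P|], so its absolute value is
    less than 1 and it vanishes. *)
Lemma legendre_convergent {R : realType} {x : R} (P Q : int) :
  irrational x -> 1 <= Q -> 2 * Q%:~R * `|Q%:~R * x - P%:~R| < 1 ->
  exists j, cf_convergent x j = P%:~R / Q%:~R.
Proof.
move=> xirr Q_ge1 PQ_close.
have [j /andP[qj_le Q_lt]] := cf_den_bracket xirr Q_ge1; exists j.
have [qj_ge1 _] := cf_den_bounds j xirr.
have Q_bounds : 1 <= Q < cf_den x j.+1 by rewrite Q_ge1.
have best := cf_error_best P xirr Q_bounds.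
set W := P * cf_den x j - cf_num x j * Q.
have W0 : W = 0.
  suff : `|W%:~R : R| < 1 by rewrite -intr_norm -[1]/(1%:~R) ltr_int; lia.
  have -> : W%:~R = Q%:~R * cf_error x j - (cf_den x j)%:~R * (Q%:~R * x - P%:~R) :> R.
    by rewrite /W intrB !intrM /cf_error; ring.
  apply: le_lt_trans PQ_close; apply: le_trans (ler_normB _ _) _.
  have Q_ge0 : 0 <= Q%:~R :> R by rewrite ler0z; lia.
  have qj_ge0 : 0 <= (cf_den x j)%:~R :> R by rewrite ler0z; lia.
  rewrite !normrM (ger0_norm Q_ge0) (ger0_norm qj_ge0) -mulrA mulr_natl mulr2n.
  by rewrite lerD ?ler_wpM2l // ler_wpM2r // ler_int.
apply/eqP; rewrite eqr_div ?intr_eq0; [|lia|lia].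
by rewrite -!intrM eqr_int; apply/eqP; move: W0; rewrite /W; lia.
Qed.

Theorem proposition2p4 (R : realType) (m : nat) (xi eta : R) (n : nat)
    (m_gt0 : (0 < m)%N)
    (xi_gt0 : 0 < xi) (xi_irr : irrational xi)
    (eta_gt0 : 0 < eta) (eta_irr : irrational eta)
    (xi_eta : xi * eta = m%:R) (eta_lt_m : eta < m%:R)
    (n_ge1 : (1 <= n)%N)
    (b_ge : 2 * m%:Z + 1 <= cf_partial xi n) :
  exists k : nat,
    [/\ (1 <= k)%N,
        cf_convergent eta k.-1
          = m%:R * ((cf_den xi n.-1)%:~R / (cf_num xi n.-1)%:~R)
      & connected_triplets m (cf_triplet xi n) (cf_triplet eta k)].
Proof.
case: n n_ge1 b_ge => // n _ b_ge; rewrite [n.+1.-1]/=.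
have xi_gt1 : 1 < xi by rewrite -(ltr_pM2r eta_gt0) mul1r xi_eta.
have [p_ge1 p'_ge0] := cf_num_bounds n xi_irr xi_gt1.
have [q_ge1 q'_ge0] := cf_den_bounds n xi_irr.
suff [j jE] : exists j, cf_convergent eta j
    = (m%:Z * cf_den xi n)%:~R / (cf_num xi n)%:~R.
  have convE : cf_convergent eta j
      = m%:R * ((cf_den xi n)%:~R / (cf_num xi n)%:~R).
    by rewrite jE intrM mulrA.
  exists j.+1; split=> //; rewrite /connected_triplets /= convE /cf_convergent.
  by field; rewrite !intr_eq0; lia.
apply: legendre_convergent => //.
have b_lt := cf_partial_lt n.+1 xi_irr.
have mobius := cf_mobius n xi_irr; have := cf_error_norm n xi_irr.
move: mobius; set A := _ + (cf_den_before xi n)%:~R => mobius.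
set p : R := (cf_num xi n)%:~R in mobius *.
have p_gt0 : 0 < p by rewrite ltr0z; lia.
have p'_ge0R : 0 <= (cf_num_before xi n)%:~R :> R by rewrite ler0z.
have X_gt : 2 * m%:R < cf_complete xi n.+1.
  apply: lt_trans b_lt; rewrite -[2 * _]/(2%:~R * m%:~R) -intrM ltr_int.
  by apply: lt_le_trans b_ge; rewrite ltrDl.
have xiA_gt : 2 * p * m%:R < xi * A by rewrite mobius; nra.
have A_gt0 : 0 < A.
  by rewrite -(pmulr_rgt0 _ xi_gt0); apply: le_lt_trans xiA_gt; rewrite !mulr_ge0 ?ler0n ?ltW.
rewrite normrM (gtr0_norm A_gt0) => errA.
have -> : p * eta - (m%:Z * cf_den xi n)%:~R = - (eta * cf_error xi n).
  by rewrite intrM -[m%:~R]/(m%:R) -xi_eta /cf_error -/p; ring.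
rewrite normrN normrM (gtr0_norm eta_gt0).
rewrite -(ltr_pM2l (mulr_gt0 xi_gt0 A_gt0)) mulr1.
have -> : xi * A * (2 * p * (eta * `|cf_error xi n|))
    = 2 * p * (xi * eta) * (`|cf_error xi n| * A) by ring.
by rewrite errA xi_eta mulr1.
Qed.
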